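(* Let $q$ be a logconcave distribution in one dimension with nonnegative support. For any $t\ge0$, let $q_t$ be the distribution obtained by restricting $q$ to $[t,\infty)$. Then the moment ratio of $q_t$, defined as $$\frac{\operatorname{Var}_{X\sim q_t}(X^2)}{\left(\mathbb{E}_{X\sim q_t}X^2\right)^2},$$ is strictly decreasing with $t$.
   Context: A one-dimensional distribution is logconcave if its density $q$ satisfies $q(\lambda x+(1-\lambda)y)\ge q(x)^\lambda q(y)^{1-\lambda}$ for all $x,y\in\mathbb{R}$, $\lambda\in[0,1]$. Nonnegative support means the support is contained in $[0,\infty)$. Restricting $q$ to a set means conditioning on it (restricting the density and renormalizing).
   Formalization: For s<t with q([t,∞))>0 (so q_t exists), the ratio at t is at most that at s, and strictly smaller if q([s,t))>0; strictness fails otherwise, as q_s=q_t (e.g. q uniform on [1,2], where the ratio is constant for t in [0,1]). *)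

(* Defs.v *)
From HB Require Import structures.
From mathcomp Require Import all_boot all_order all_algebra.
From mathcomp Require Import all_classical all_reals all_analysis.

Set Implicit Arguments.
Unset Strict Implicit.
Unset Printing Implicit Defensive.

Import Order.TTheory GRing.Theory Num.Theory.
Import numFieldNormedType.Exports.

Local Open Scope classical_set_scope.
Local Open Scope ring_scope.

(** [powR] satisfies [0 `^ 0 = 1] and [0 `^ a = 0] for [a != 0], so the
    inequality carries no information at the endpoints [l = 0] and [l = 1], and
    when [q] is nonnegative, none when [q x * q y = 0]. *)
Definition logconcave (R : realType) (q : R -> R) : Prop :=
  forall x y l : R, 0 <= l <= 1 ->
    q x `^ l * q y `^ (1 - l) <= q (l * x + (1 - l) * y).

(** The total mass [\int q = 1] is implied, since [Q] is a probability. *)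
Definition has_density (R : realType) (Q : probability (measurableTypeR R) R)
    (q : R -> R) : Prop :=
  [/\ measurable_fun [set: R] q,
      forall x, 0 <= q x &
      forall A : set (measurableTypeR R), measurable A ->
        Q A = (\int[lebesgue_measure]_(x in A) (q x)%:E)%E].

(** For measurable [U], this is [U |-> Q (U `&` `[t, +oo[) / Q `[t, +oo[].
    [mnormalize] takes a default measure (here [Q]), used only when
    [Q `[t, +oo[ = 0], in which case the conditioning is meaningless. *)
Definition restrict_ray (R : realType) (Q : probability (measurableTypeR R) R)
    (t : R) : probability (measurableTypeR R) R :=
  mnormalize (mrestr Q (measurable_itv `[t, +oo[)) Q.

(** Logconcave densities have finite moments of all orders, and so do their
    restrictions to rays, so the values under [fine] are finite for them. *)
Definition moment_ratio (R : realType)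
    (Q : probability (measurableTypeR R) R) : R :=
  fine 'V_Q[fun x : R => x ^+ 2] / fine 'E_Q[fun x : R => x ^+ 2] ^+ 2.

(* Main.v *)
Require Import Defs.
From HB Require Import structures.
From mathcomp Require Import all_boot all_order all_algebra.
From mathcomp Require Import ring lra.
From mathcomp Require Import all_classical all_reals all_analysis.
From mathcomp Require Import measurable_realfun.
Import Order.TTheory GRing.Theory Num.Theory.
Import numFieldNormedType.Exports.
Local Open Scope classical_set_scope.
Local Open Scope ring_scope.

Set Implicit Arguments.
Unset Strict Implicit.
Unset Printing Implicit Defensive.

(** Write [M_k(u)] for the integral of [x^k q] over [[u, +oo[]; the moment ratio
    of [q_u] is [M_4 M_0 / M_2^2 - 1]. Let [e] be the exponential function whose
    moments of orders 0 and 2 over [[t, +oo[] are those of [q]. Since [q / e] is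
    logconcave, [q - e] has signs [-, +, -] on [[t, +oo[], so [e] has the larger
    fourth moment there, while [q / e] is at most 1 and nondecreasing to the
    left of [t]. Replacing [q] by [e] on [[t, +oo[] only makes the desired
    inequality harder, because [M_4(s) / M_4(t)] decreases. After this
    replacement, [q] is [w e] on [[s, +oo[] with [w <= 1] nondecreasing, and
    testing against a polynomial [a x^4 - 2 m x^2 + g] reduces the claim to the
    functions [e 1_{x >= u}] with [s <= u <= t], for which the ratio is
    explicit. *)

(** * Logconcave functions compared with exponentials *)

Section logconcave_chord.
Context (R : realType) (q : R -> R).
Hypothesis q_logconcave : logconcave q.

(** Logconcavity at the weight [l] with [y = l x + (1 - l) z]. Lower bounds [expR a] and [expR b]
    replace the values of [q]: they keep both values positive, away from the degenerate cases of
    [powR], and let affine exponents be inserted directly. *)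
Lemma logconcave_chord a b x y z : x < z -> x <= y <= z ->
  expR a <= q x -> expR b <= q z ->
  expR ((a * (z - y) + b * (y - x)) / (z - x)) <= q y.
Proof.
move=> xz /andP[xy yz] aq bq.
have zx0 : 0 < z - x by rewrite subr_gt0.
have zx : z - x != 0 by rewrite gt_eqF.
pose l := (z - y) / (z - x).
have l0 : 0 <= l by rewrite divr_ge0 ?subr_ge0// ltW.
have l1 : l <= 1 by rewrite ler_pdivrMr// mul1r lerD2l lerN2.
have /(_ l) := q_logconcave x z; rewrite l0 l1 => /(_ isT).
have -> : l * x + (1 - l) * z = y by rewrite /l; field.
apply: le_trans.
have -> : (a * (z - y) + b * (y - x)) / (z - x) = a * l + b * (1 - l).
  by rewrite /l; field.
rewrite expRD !expRM; apply: ler_pM; rewrite ?powR_ge0//.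
- by apply: ge0_ler_powR; rewrite // nnegrE ?expR_ge0// (le_trans (expR_ge0 a)).
- by apply: ge0_ler_powR; rewrite ?subr_ge0// nnegrE ?expR_ge0//
    (le_trans (expR_ge0 b)).
Qed.

Variables c b : R.
Let e x := expR (c - b * x).

(** The exponent of [e] is affine, so its chord is itself: the set where [q >= e] is an interval. *)
Lemma logconcave_ge_expR x y z : x <= y <= z ->
  e x <= q x -> e z <= q z -> e y <= q y.
Proof.
move=> /andP[]; rewrite le_eqVlt => /predU1P[->//|xy].
rewrite le_eqVlt => /predU1P[->//|yz] ex ez.
have xz := lt_trans xy yz.
have := @logconcave_chord (c - b * x) (c - b * z) x y z xz.
rewrite (ltW xy) (ltW yz) => /(_ isT ex ez).
apply: le_trans; rewrite /e ler_expR le_eqVlt; apply/orP; left; apply/eqP.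
by field; rewrite subr_eq0 gt_eqF.
Qed.

(** Since [y < z], the left endpoint has positive weight in the chord, so a strict inequality there
    survives at [y]. *)
Lemma logconcave_gt_expR x y z : x <= y < z ->
  e x < q x -> e z <= q z -> e y < q y.
Proof.
move=> /andP[xy yz] ex ez; have xz := le_lt_trans xy yz.
have yz' := ltW yz.
have qx0 : 0 < q x by rewrite (lt_trans _ ex)// expR_gt0.
have lnq : c - b * x < ln (q x) by rewrite -ltr_expR lnK.
have := @logconcave_chord (ln (q x)) (c - b * z) x y z xz.
rewrite xy yz' lnK// lexx => /(_ isT isT ez); apply: lt_le_trans.
rewrite /e ltr_expR ltr_pdivlMr ?subr_gt0//.
have : (c - b * x) * (z - y) < ln (q x) * (z - y).
  by rewrite ltr_pM2r ?subr_gt0.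
lra.
Qed.

(** The ratio [q / e] is logconcave, at most 1 at [x] and at least 1 at [z], hence it cannot fall
    below its value at [x] in between. Denominators are cleared in the conclusion. *)
Lemma logconcave_ratio_homo x y z : x <= y <= z -> 0 <= q x -> 0 <= q y ->
  q x <= e x -> e z <= q z -> q x * e y <= q y * e x.
Proof.
move=> /andP[]; rewrite le_eqVlt => /predU1P[->//|xy] yz qx0 qy0 qe ez.
move: qx0; rewrite le_eqVlt => /predU1P[<-|qx0].
  by rewrite mul0r mulr_ge0// expR_ge0.
have xz := lt_le_trans xy yz.
(* The multiple [expR r * e] meets [q] at [x] and, as [r <= 0], stays below [q] at [z]; the chord
   bound then gives [expR r * e y <= q y]. *)
pose r := ln (q x) - (c - b * x).
have r0 : r <= 0 by rewrite subr_le0 -ler_expR lnK.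
have := @logconcave_chord (c - b * x + r) (c - b * z + r) x y z xz.
rewrite yz (ltW xy) => /(_ isT).
have -> : expR (c - b * x + r) = q x by rewrite /r addrC subrK lnK.
rewrite lexx => /(_ isT).
have ezr : expR (c - b * z + r) <= q z.
  by rewrite (le_trans _ ez)// ler_expR gerDl.
move=> /(_ ezr).
have -> : ((c - b * x + r) * (z - y) + (c - b * z + r) * (y - x)) / (z - x)
    = (c - b * y) + r by field; rewrite subr_eq0 gt_eqF.
rewrite expRD => H.
have -> : q x = e x * expR r by rewrite /r /e -expRD addrC subrK lnK.
have := ler_wpM2r (expR_ge0 (c - b * x)) H.
by rewrite /e; congr (_ <= _); ring.
Qed.

End logconcave_chord.

(** * Polynomial inequalities and sign patterns *)

Section sign_change.
Context (R : realType).

(* For the exponential tail of rate [b] on [[u, +oo[], with [y = b * u], the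
   moments of order 0, 2, 4 are proportional to [1], [y^2 + 2 y + 2] and
   [y^4 + 4 y^3 + 12 y^2 + 24 y + 24]. *)
Lemma expR_ratio_poly_lt (y z : R) : 0 <= y -> y < z ->
  (z^+4 + 4*z^+3 + 12*z^+2 + 24*z + 24) * (y^+2 + 2*y + 2)^+2 <
  (y^+4 + 4*y^+3 + 12*y^+2 + 24*y + 24) * (z^+2 + 2*z + 2)^+2.
Proof.
(* With [A = c^2 + 1] the quadratic becomes [A] and the quartic [A^2 + 4 A + 4 (2 c + 1)]. The ratio
   is thus [1 + 4 / A + 4 (2 c + 1) / A^2], and both nonconstant terms decrease for [c >= 1]: these
   are [h1] and [h3]. *)
move=> y0 yz; set c := y + 1; set d := z + 1.
have c1 : 1 <= c by rewrite /c; lra.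
have cd : c < d by rewrite /c /d; lra.
have -> : y = c - 1 by rewrite /c; ring.
have -> : z = d - 1 by rewrite /d; ring.
clearbody c d.
have -> : (c - 1)^+4 + 4*(c - 1)^+3 + 12*(c - 1)^+2 + 24*(c - 1) + 24 =
  (c^+2 + 1)^+2 + 4 * (c^+2 + 1) + 4 * (2 * c + 1) by ring.
have -> : (d - 1)^+4 + 4*(d - 1)^+3 + 12*(d - 1)^+2 + 24*(d - 1) + 24 =
  (d^+2 + 1)^+2 + 4 * (d^+2 + 1) + 4 * (2 * d + 1) by ring.
have -> : (c - 1)^+2 + 2*(c - 1) + 2 = c^+2 + 1 by ring.
have -> : (d - 1)^+2 + 2*(d - 1) + 2 = d^+2 + 1 by ring.
have c2 : 0 < c^+2 + 1 by nra.
have d2 : 0 < d^+2 + 1 by nra.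
have cd2 : c^+2 + 1 < d^+2 + 1 by nra.
have h1 : (d^+2 + 1) * (c^+2 + 1) * (c^+2 + 1) <
  (c^+2 + 1) * (d^+2 + 1) * (d^+2 + 1).
  by rewrite [X in X * _ < _]mulrC ltr_pM2l// mulr_gt0.
have h2 : (2 * d + 1) * (c^+2 + 1) < (2 * c + 1) * (d^+2 + 1).
  rewrite -subr_gt0.
  have -> : (2 * c + 1) * (d^+2 + 1) - (2 * d + 1) * (c^+2 + 1) =
    (d - c) * (2 * c * d - 2 + (c + d)) by ring.
  by apply: mulr_gt0; nra.
have h3 : (2 * d + 1) * (c^+2 + 1) * (c^+2 + 1) <
  (2 * c + 1) * (d^+2 + 1) * (d^+2 + 1).
  by apply: ltr_pM => //; nra.
rewrite -subr_gt0.
have -> : ((c^+2 + 1)^+2 + 4 * (c^+2 + 1) + 4 * (2 * c + 1)) * (d^+2 + 1)^+2 -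
    ((d^+2 + 1)^+2 + 4 * (d^+2 + 1) + 4 * (2 * d + 1)) * (c^+2 + 1)^+2 =
   4 * ((c^+2 + 1) * (d^+2 + 1) * (d^+2 + 1)
     - (d^+2 + 1) * (c^+2 + 1) * (c^+2 + 1))
   + 4 * ((2 * c + 1) * (d^+2 + 1) * (d^+2 + 1)
     - (2 * d + 1) * (c^+2 + 1) * (c^+2 + 1)) by ring.
by lra.
Qed.

(* A convex quadratic in [x^2] has signs [+, -, +] on the half line; take for
   [u] its first root and for [om] the weight at its second root. *)
Lemma sign_change_weight (a m g s t : R) (w : R -> R) :
  0 < a -> 0 <= s -> s < t ->
  (forall x, s <= x < t -> 0 <= w x <= 1) ->
  (forall x y, s <= x -> x <= y -> y < t -> w x <= w y) ->
  exists om u, [/\ s <= u < t, 0 <= om <= 1, 0 < w s -> 0 < om,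
    forall x, s <= x < u -> 0 <= a * x^+4 - 2 * m * x^+2 + g &
    forall x, u <= x < t -> om * (a * x^+4 - 2 * m * x^+2 + g) <=
                            w x * (a * x^+4 - 2 * m * x^+2 + g)].
Proof.
move=> a0 s0 st w01 wnd.
have [[x0 [/andP[sx0 x0t] px0]]|nopx] :=
  pselect (exists x, s <= x < t /\ a * x^+4 - 2 * m * x^+2 + g < 0); last first.
  have p0 x : s <= x < t -> 0 <= a * x^+4 - 2 * m * x^+2 + g.
    by move=> sxt; rewrite leNgt; apply/negP => px; apply: nopx; exists x.
  exists (w s), s; split => //.
  - by rewrite lexx.
  - by apply: w01; rewrite lexx.
  - by move=> x /andP[sx xs]; have := le_lt_trans sx xs; rewrite ltxx.
  - move=> x /andP[sx xt]; apply: ler_wpM2r; first by apply: p0; rewrite sx.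
    exact: wnd.
(* The roots in [x^2] are [h - r] and [h + r]. The negative value at [x0] makes the radicand
   nonnegative and puts [x0^2] strictly between the roots. *)
pose h := m / a; pose r := Num.sqrt (h^+2 - g / a).
have pE x : a * x^+4 - 2 * m * x^+2 + g = a * ((x^+2 - h)^+2 - (h^+2 - g / a)).
  by rewrite /h; field; rewrite gt_eqF.
have r2 : h^+2 - g / a = r^+2.
  rewrite /r sqr_sqrtr//; move: px0; rewrite pE pmulr_rlt0// subr_lt0 => /ltW.
  exact/le_trans/sqr_ge0.
have r0 : 0 <= r by exact: sqrtr_ge0.
have {}pE x : a * x^+4 - 2 * m * x^+2 + g =
  a * ((x^+2 - (h - r)) * (x^+2 - (h + r))).
  by rewrite pE r2; congr (_ * _); ring.
have x00 : 0 <= x0 by exact: le_trans sx0.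
have {}px0 : (x0^+2 - (h - r)) * (x0^+2 - (h + r)) < 0.
  by move: px0; rewrite pE pmulr_rlt0.
have y1 : h - r < x0^+2 by nra.
have y2 : x0^+2 < h + r by nra.
(* This holds for negative [y] too, where [Num.sqrt] is 0; so [h - r] may have either sign. *)
have sqrt_le y x : 0 <= x -> (Num.sqrt y <= x) = (y <= x^+2).
  move=> x0'; rewrite -{1}(ger0_norm x0') -sqrtr_sqr.
  rewrite ler_sqrt ?sqr_ge0//.
pose x2 := Num.sqrt (h + r).
have x02 : x0 < x2 by rewrite ltNge sqrt_le// -ltNge.
(* Before [x2] the polynomial is at most 0 and [w <= om]; after [x2] both signs flip. If [x2] lies
   beyond the interval, only an upper bound of [w] is needed, and 1 serves. *)
pose om := if x2 < t then w x2 else 1.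
exists om, (Num.max s (Num.sqrt (h - r))); split.
- by rewrite le_max lexx/= gt_max st/= (le_lt_trans _ x0t)// sqrt_le// ltW.
- rewrite /om; case: ifPn => x2t; last by rewrite ler01 lexx.
  by apply: w01; rewrite x2t (le_trans sx0)// ltW.
- rewrite /om; case: ifPn => x2t // ws; apply: lt_le_trans ws _.
  by apply: wnd; rewrite // (le_trans sx0)// ltW.
- move=> x /andP[sx]; rewrite lt_max => /orP[xs|].
    by have := le_lt_trans sx xs; rewrite ltxx.
  have x0' : 0 <= x by exact: le_trans sx.
  rewrite ltNge sqrt_le// -ltNge => xy1.
  by rewrite pE; apply: mulr_ge0; [exact: ltW|nra].
- move=> x; rewrite ge_max => /andP[/andP[sx y1x] xt].
  have x0' : 0 <= x by exact: le_trans sx.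
  move: y1x; rewrite sqrt_le// => y1x; rewrite pE.
  have [x2x|xx2] := leP x2 x.
    apply: ler_wpM2r.
      move: x2x; rewrite sqrt_le// => x2x.
      by apply: mulr_ge0; [exact: ltW|apply: mulr_ge0; lra].
    rewrite /om (le_lt_trans x2x xt); apply: wnd => //.
    by rewrite (le_trans sx0)// ltW.
  apply: ler_wnM2r.
    have {}xx2 : x^+2 <= h + r.
      have hr0 : 0 <= h + r by nra.
      by rewrite -(sqr_sqrtr hr0) -/x2; nra.
    by rewrite pmulr_rle0//; nra.
  rewrite /om; case: ifPn => x2t; first by apply: wnd => //; exact: ltW.
  by have /andP[] : 0 <= w x <= 1 by apply: w01; rewrite sx.
Qed.
End sign_change.

(** * Moments over a set and their comparison by test polynomials *)

Section moments.
Context (R : realType).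
Notation mu := (@lebesgue_measure R).
Implicit Types (D E : set (measurableTypeR R)) (f g : R -> R).

Definition moment D f (k : nat) : R := \int[mu]_(x in D) (x ^+ k * f x).

Definition has_moments D f :=
  forall k, mu.-integrable D (EFin \o (fun x => x ^+ k * f x)).

Lemma has_momentsS D E f : measurable D -> measurable E -> E `<=` D ->
  has_moments D f -> has_moments E f.
Proof. by move=> mD mE ED mf k; exact: integrableS (mf k). Qed.

Lemma moment_ge0 D f k : (forall x, D x -> 0 <= x) ->
  (forall x, 0 <= f x) -> 0 <= moment D f k.
Proof.
move=> D0 f0; apply: Rintegral_ge0 => x Dx.
by rewrite mulr_ge0// exprn_ge0// D0.
Qed.

Lemma moment_itv_split (s t : R) (e : itv_bound R) f k :
  s <= t -> (BLeft t <= e)%O -> has_moments [set` Interval (BLeft s) e] f ->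
  moment [set` Interval (BLeft s) e] f k =
  moment `[s, t[ f k + moment [set` Interval (BLeft t) e] f k.
Proof.
move=> st te mf; rewrite /moment (@itv_bndbnd_setU _ _ _ (BLeft t))//.
rewrite Rintegral_setU//.
- by rewrite -itv_bndbnd_setU.
- by rewrite disj_set2E; apply/disj_setPS => x [/=]; rewrite !in_itv/=
    => /andP[_ xt] /andP[]; rewrite leNgt xt.
Qed.

Lemma integral_biquadratic D f (a b c : R) : measurable D -> has_moments D f ->
  mu.-integrable D (EFin \o (fun x => (a * x^+4 + b * x^+2 + c) * f x)) /\
  \int[mu]_(x in D) ((a * x^+4 + b * x^+2 + c) * f x) =
  a * moment D f 4 + b * moment D f 2 + c * moment D f 0.
Proof.
move=> mD mf.
have mZ k r : mu.-integrable D (EFin \o (fun x => r * (x ^+ k * f x))).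
  by have := integrableZl mD r (mf k).
have -> : (fun x => (a * x^+4 + b * x^+2 + c) * f x) =
    (fun x => (a * (x^+4 * f x) + b * (x^+2 * f x)) + c * (x ^+ 0 * f x)).
  by apply/funext => x; rewrite expr0; ring.
have m2 : mu.-integrable D (EFin \o
    (fun x => a * (x^+4 * f x) + b * (x^+2 * f x))).
  by have := integrableD mD (mZ 4%N a) (mZ 2%N b).
split; first by have := integrableD mD m2 (mZ 0%N c).
by rewrite !RintegralD//; congr (_ + _ + _); apply: RintegralZl => //;
  exact: mf.
Qed.

(** Separate coefficients on the two sides allow comparison with 0 and with a scaled test
    polynomial, besides testing [f] and [g] against the same one. *)
Lemma ler_moments D f g (a b c a' b' c' : R) : measurable D ->
  has_moments D f -> has_moments D g ->
  (forall x, D x -> (a * x^+4 + b * x^+2 + c) * f x <=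
                    (a' * x^+4 + b' * x^+2 + c') * g x) ->
  a * moment D f 4 + b * moment D f 2 + c * moment D f 0 <=
  a' * moment D g 4 + b' * moment D g 2 + c' * moment D g 0.
Proof.
move=> mD mf mg fg.
have [if_ <-] := integral_biquadratic a b c mD mf.
have [ig <-] := integral_biquadratic a' b' c' mD mg.
exact: le_Rintegral.
Qed.

(** If the integral of [f] were zero, [f] would vanish almost everywhere, hence so would [g]. The
    auxiliary [g] only has to detect that the set where [f] is nonzero is not negligible. *)
Lemma Rintegral_gt0 D f g : measurable D ->
  mu.-integrable D (EFin \o f) -> measurable_fun D g ->
  (forall x, D x -> 0 <= f x) -> (forall x, D x -> f x = 0 -> g x = 0) ->
  \int[mu]_(x in D) g x != 0 -> 0 < \int[mu]_(x in D) f x.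
Proof.
move=> mD if_ mg f0 fg; apply: contraTT => fle0.
have f00 : \int[mu]_(x in D) f x = 0.
  by apply/eqP; rewrite eq_le leNgt fle0 Rintegral_ge0.
have : ae_eq mu D (EFin \o f) (cst 0%E).
  apply/ae_eq_integral_abs => //; first exact: measurable_int if_.
  rewrite -[RHS]/(0%:E) -f00 /Rintegral fineK.
    by apply: eq_integral => x /[!inE] Dx /=; rewrite ger0_norm ?f0.
  exact: integrable_fin_num.
move=> fae; have gae : ae_eq mu D (EFin \o g) (cst 0%E).
  move: fae; apply: filterS => x fx Dx /=.
  by move: (fx Dx) => /= -[fx0]; rewrite fg.
rewrite negbK /Rintegral (ae_eq_integral (cst 0%E))//.
- by rewrite integral0.
- exact/measurable_EFinP.
Qed.

Lemma lt_Rintegral_ray (t B : R) f g :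
  mu.-integrable `[t, +oo[ (EFin \o f) ->
  mu.-integrable `[t, +oo[ (EFin \o g) ->
  (forall x, t <= x -> f x <= g x) ->
  (forall x, t <= x -> B < x -> f x < g x) ->
  \int[mu]_(x in `[t, +oo[) f x < \int[mu]_(x in `[t, +oo[) g x.
Proof.
move=> if_ ig fg fgB.
have mD : measurable (`[t, +oo[%classic : set (measurableTypeR R)) by [].
rewrite -subr_gt0 -RintegralB//.
(* The interval []m, m + 1]] has measure 1 and lies where the inequality is strict; its indicator is
   the witness. *)
pose m := Num.max t B.
have sub : `]m, m + 1] `<=` `[t, +oo[%classic.
  move=> x /=; rewrite !in_itv/= andbT => /andP[+ _].
  by rewrite /m gt_max => /andP[/ltW].
apply: (@Rintegral_gt0 _ _ (\1_(`]m, m + 1]%classic))) => //.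
- by have := integrableB mD ig if_.
- by move=> x /=; rewrite in_itv/= andbT => tx; rewrite subr_ge0 fg.
- move=> x /=; rewrite in_itv/= andbT => tx fgx.
  rewrite indicE memNset//= in_itv/= => /andP[+ _].
  rewrite /m gt_max => /andP[_ Bx]; have := fgB _ tx Bx.
  by rewrite -subr_gt0 fgx ltxx.
- rewrite /Rintegral integral_indic// setIidl//= lebesgue_measure_itv/=.
  by rewrite lte_fin ltrDl ltr01/= (addrC m) addrK oner_neq0.
Qed.

Lemma ltr_moments (t B : R) f g (a b c a' b' c' : R) :
  has_moments `[t, +oo[ f -> has_moments `[t, +oo[ g ->
  (forall x, t <= x -> (a * x^+4 + b * x^+2 + c) * f x <=
                    (a' * x^+4 + b' * x^+2 + c') * g x) ->
  (forall x, t <= x -> B < x -> (a * x^+4 + b * x^+2 + c) * f x <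
                    (a' * x^+4 + b' * x^+2 + c') * g x) ->
  a * moment `[t, +oo[ f 4 + b * moment `[t, +oo[ f 2 +
    c * moment `[t, +oo[ f 0 <
  a' * moment `[t, +oo[ g 4 + b' * moment `[t, +oo[ g 2 +
    c' * moment `[t, +oo[ g 0.
Proof.
move=> mf mg fg fgB.
have mD : measurable (`[t, +oo[%classic : set (measurableTypeR R)) by [].
have [if_ <-] := integral_biquadratic a b c mD mf.
have [ig <-] := integral_biquadratic a' b' c' mD mg.
exact: lt_Rintegral_ray fgB.
Qed.

(** The integrand [(x^2 - t^2) f] vanishes beyond [t] only where [f] does, so [f] itself witnesses
    positivity. This is the solvability condition for matching an exponential. *)
Lemma moment2_gt (t : R) f : 0 <= t -> (forall x, 0 <= f x) ->
  measurable_fun setT f -> has_moments `[t, +oo[ f ->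
  0 < moment `[t, +oo[ f 0 ->
  t^+2 * moment `[t, +oo[ f 0 < moment `[t, +oo[ f 2.
Proof.
move=> t0 f0 mf if_ f00.
have mD : measurable (`[t, +oo[%classic : set (measurableTypeR R)) by [].
have sub : `]t, +oo[ `<=` `[t, +oo[%classic.
  by move=> x /=; rewrite !in_itv/= !andbT => /ltW.
have [ih eh] := integral_biquadratic 0 1 (- t^+2) mD if_.
rewrite -subr_gt0.
have -> : moment `[t, +oo[ f 2 - t^+2 * moment `[t, +oo[ f 0 =
  0 * moment `[t, +oo[ f 4 + 1 * moment `[t, +oo[ f 2
    + (- t^+2) * moment `[t, +oo[ f 0 by ring.
(* The endpoint is removed because [x^2 - t^2] vanishes there whatever [f] is. *)
rewrite -eh -Rintegral_itv_obnd_cbnd; last exact: integrableS ih.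
apply: (@Rintegral_gt0 _ _ f) => //.
- exact: integrableS ih.
- exact: measurable_funTS.
- move=> x /=; rewrite in_itv/= andbT => tx; apply: mulr_ge0 => //.
  nra.
- move=> x /=; rewrite in_itv/= andbT => tx /eqP;
    rewrite mulf_eq0 => /orP[|/eqP//].
  rewrite mul0r add0r mul1r subr_eq0 eqf_sqr => /orP[] /eqP; lra.
- have i0 : mu.-integrable `[t, +oo[ (EFin \o f).
    by have := if_ 0%N; congr (mu.-integrable _ _); apply/funext => x /=;
      rewrite expr0 mul1r.
  rewrite Rintegral_itv_obnd_cbnd; last exact: integrableS i0.
  rewrite gt_eqF//; move: f00; rewrite /moment; congr (_ < _).
  by congr Rintegral; apply/funext => x; rewrite expr0 mul1r.
Qed.

End moments.

(** * Explicit moments of exponential tails *)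

Section expR_moments.
Context (R : realType).
Notation mu := (@lebesgue_measure R).
Implicit Types (b c u x : R).

Lemma exprn_le_expR b k x : 0 < b -> 0 <= x ->
  x ^+ k <= k`!%:R * b ^- k * expR (b * x).
Proof.
move=> b0 x0; have bx0 : 0 <= b * x by rewrite mulr_ge0// ltW.
have bx : (b * x) ^+ k <= k`!%:R * expR (b * x).
  case: k => [|k]; first by rewrite expr0 mul1r -expR0 ler_expR.
  have := expR_ge1Dxn k bx0; set z := _ / _ => h.
  have -> : (b * x) ^+ k.+1 = k.+1`!%:R * z.
    by rewrite /z [RHS]mulrC divfK// pnatr_eq0 -lt0n fact_gt0.
  by rewrite ler_wpM2l// (le_trans _ h)// lerDr.
have bk0 : 0 < b ^+ k by rewrite exprn_gt0.
rewrite mulrAC ler_pdivlMr// mulrC.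
by move: bx; rewrite exprMn.
Qed.

Lemma continuous_expR_affine c b : continuous (fun x => expR (c - b * x)).
Proof.
move=> x; apply: (@continuous_comp _ _ _ (fun x => c - b * x) expR).
  apply: continuousB; first exact: cst_continuous.
  by apply: continuousM => //; exact: cst_continuous.
exact: continuous_expR.
Qed.

Lemma measurable_expR_affine c b (D : set (measurableTypeR R)) :
  measurable_fun D (fun x => expR (c - b * x)).
Proof.
by apply: measurable_funTS; apply: continuous_measurable_fun;
  exact: continuous_expR_affine.
Qed.

Lemma cvg_expR_affine c b : 0 < b -> expR (c - b * x) @[x --> +oo] --> (0 : R).
Proof.
move=> b0.
rewrite (_ : (fun x => _) = (fun x =>
  expR c * ((fun z => expR (- z)) \o (fun z => b * z)) x)); last first.
  by apply/funext => x /=; rewrite expRD.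
rewrite -(mulr0 (expR c)); apply: cvgMr.
apply: (@cvg_comp _ _ _ _ _ _ (pinfty_nbhs R)); last exact: cvgr_expR.
exact: gt0_cvgMry.
Qed.

Lemma cvg_poly_expR (P : {poly R}) c b : 0 < b ->
  P.[x] * expR (c - b * x) @[x --> +oo] --> (0 : R).
Proof.
move=> b0.
have monomial k : x ^+ k * expR (c - b * x) @[x --> +oo] --> (0 : R).
  (* Half of the rate absorbs [x ^ k]; the other half still decays. *)
  have b20 : 0 < b / 2 by rewrite divr_gt0.
  pose K := k`!%:R * (b / 2) ^- k.
  apply: (@squeeze_cvgr _ _ _ _ (fun=> 0) (fun x => K * expR (c - b / 2 * x))).
  - near=> x; have x0 : 0 <= x by near: x; exact: nbhs_pinfty_ge.
    rewrite mulr_ge0 ?exprn_ge0 ?expR_ge0//=.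
    have -> : K * expR (c - b / 2 * x) =
      K * expR (b / 2 * x) * expR (c - b * x).
      by rewrite -[RHS]mulrA -expRD; congr (_ * expR _); field.
    by rewrite ler_wpM2r ?expR_ge0// exprn_le_expR.
  - exact: cvg_cst.
  - by rewrite -(mulr0 K); apply: cvgMr; exact: cvg_expR_affine.
(* The extra factor [x ^ k] strengthens the induction: multiplying [P] by the variable just raises
   [k]. *)
suff : forall k, x ^+ k * P.[x] * expR (c - b * x) @[x --> +oo] --> (0 : R).
  move=> /(_ 0%N); rewrite (_ : (fun x => _) =
    (fun x => P.[x] * expR (c - b * x)))//.
  by apply/funext => x; rewrite expr0 mul1r.
elim/poly_ind: P => [k|P r IH k].
  rewrite (_ : (fun x => _) = fun=> 0); first exact: cvg_cst.
  by apply/funext => x; rewrite horner0 mulr0 mul0r.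
rewrite (_ : (fun x => _) = fun x =>
  x ^+ k.+1 * P.[x] * expR (c - b * x) + r * (x ^+ k * expR (c - b * x)));
    last first.
  by apply/funext => x; rewrite hornerD hornerMX hornerC exprS; ring.
rewrite -[0]addr0 -[X in _ + X](mulr0 r).
by apply: cvgD => //; apply: cvgMr; exact: monomial.
Unshelve. all: by end_near. Qed.

(** The antiderivative is [- P(x) expR (c - b x)], which tends to 0 at infinity. A moment of order
    [k] follows once [P] solves [b P - P' = x ^ k]. *)
Lemma integral_poly_expR (P : {poly R}) c b u : 0 < b ->
  (forall x, u <= x -> 0 <= b * P.[x] - P^`().[x]) ->
  (\int[mu]_(x in `[u, +oo[) ((b * P.[x] - P^`().[x]) * expR (c - b * x))%:E =
   (P.[u] * expR (c - b * u))%:E)%E.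
Proof.
move=> b0 bP0.
pose F x := - (P.[x] * expR (c - b * x)).
have dF x : is_derive x 1 F ((b * P.[x] - P^`().[x]) * expR (c - b * x)).
  rewrite /F; apply: is_derive_eq.
  by rewrite /GRing.scale/=; ring.
have cF : continuous F.
  by move=> x; apply/differentiable_continuous/derivable1_diffP/ex_derive.
rewrite (@ge0_continuous_FTC2y _ _ F _ 0)//.
- by rewrite /F EFinN oppeK add0e.
- by move=> x ux; rewrite mulr_ge0 ?expR_ge0// bP0.
- apply: continuous_subspaceT => x.
  rewrite /continuous_at; apply: cvgM.
    apply: cvgB; last exact: continuous_horner.
    by apply: cvgM; [exact: cvg_cst|exact: continuous_horner].
  exact: continuous_expR_affine.
- by rewrite -oppr0; apply: cvgN; exact: cvg_poly_expR.
- by apply: cvg_at_right_filter; exact: cF.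
- by move=> x _; rewrite derive1E derive_val.
Qed.

Lemma integrable_expR c b u : 0 < b ->
  mu.-integrable `[u, +oo[ (EFin \o (fun x => expR (c - b * x))).
Proof.
move=> b0; apply/integrableP; split.
  by apply/measurable_EFinP; exact: measurable_expR_affine.
have E x : b * (b^-1)%:P.[x] - ((b^-1)%:P)^`().[x] = 1.
  by rewrite derivC horner0 hornerC subr0 divff// gt_eqF.
have := @integral_poly_expR (b^-1)%:P c b u b0 => h.
under eq_integral => x _ do
  rewrite /= ger0_norm ?expR_ge0// -[expR _]mul1r -(E x).
by rewrite h ?ltry// => x _; rewrite E.
Qed.

Lemma has_moments_le_expR (f : R -> R) c b u : 0 < b -> 0 <= u ->
  measurable_fun setT f -> (forall x, u <= x -> 0 <= f x <= expR (c - b * x)) ->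
  has_moments `[u, +oo[ f.
Proof.
move=> b0 u0 mf f0 k; have b20 : 0 < b / 2 by rewrite divr_gt0.
have mD : measurable (`[u, +oo[%classic : set (measurableTypeR R)) by [].
pose K := k`!%:R * (b / 2) ^- k.
have := integrableZl mD K (integrable_expR c u b20).
apply: le_integrable => //.
  apply/measurable_EFinP; apply: measurable_funM; last exact: measurable_funTS.
  by apply: measurable_funX.
move=> x /=; rewrite in_itv/= andbT => ux.
have x0 : 0 <= x by exact: le_trans ux.
have /andP[fx0 fx] := f0 _ ux.
have K0 : 0 <= K by rewrite mulr_ge0// invr_ge0 exprn_ge0// ltW.
rewrite lee_fin !ger0_norm; last 2 first.
  by rewrite mulr_ge0 ?expR_ge0.
  by rewrite mulr_ge0 ?exprn_ge0.
have -> : K * expR (c - b / 2 * x) = K * expR (b / 2 * x) * expR (c - b * x).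
  by rewrite -[RHS]mulrA -expRD; congr (_ * expR _); field.
by apply: ler_pM; rewrite ?exprn_ge0// exprn_le_expR.
Qed.

Lemma has_moments_expR c b u : 0 < b -> 0 <= u ->
  has_moments `[u, +oo[ (fun x => expR (c - b * x)).
Proof.
move=> b0 u0; apply: (has_moments_le_expR b0 u0).
  exact: measurable_expR_affine.
by move=> x _; rewrite expR_ge0 /=.
Qed.

Lemma moment_poly_expR (P : {poly R}) c b u k : 0 < b -> 0 <= u ->
  (forall x, b * P.[x] - P^`().[x] = x ^+ k) ->
  moment `[u, +oo[ (fun x => expR (c - b * x)) k = P.[u] * expR (c - b * u).
Proof.
move=> b0 u0 E; rewrite /moment /Rintegral.
under eq_integral do rewrite -E.
by rewrite integral_poly_expR// => x ux; rewrite E exprn_ge0// (le_trans u0).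
Qed.

Lemma moment0_expR c b u : 0 < b -> 0 <= u ->
  moment `[u, +oo[ (fun x => expR (c - b * x)) 0 = expR (c - b * u) / b.
Proof.
move=> b0 u0; rewrite (@moment_poly_expR (b^-1)%:P)//.
  by rewrite hornerC mulrC.
by move=> x; rewrite derivC horner0 hornerC subr0 divff// gt_eqF.
Qed.

Lemma moment2_expR c b u : 0 < b -> 0 <= u ->
  moment `[u, +oo[ (fun x => expR (c - b * x)) 2 =
  expR (c - b * u) / b ^+ 3 * ((b * u) ^+ 2 + 2 * (b * u) + 2).
Proof.
move=> b0 u0; have bn0 : b != 0 by rewrite gt_eqF.
(* The coefficients solve [b P - P' = x^2] from the top degree down. *)
rewrite (@moment_poly_expR (b^-1 *: 'X^2 + (2 / b^+2) *: 'X +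
  (2 / b ^+ 3)%:P))//.
  by rewrite !(hornerD, hornerZ, hornerXn, hornerX, hornerC); field.
move=> x; rewrite !(derivD, derivZ, derivXn, derivX, derivC).
by rewrite !(hornerD, hornerZ, hornerMn, hornerXn, hornerX, hornerC)/=; field.
Qed.

Lemma moment4_expR c b u : 0 < b -> 0 <= u ->
  moment `[u, +oo[ (fun x => expR (c - b * x)) 4 =
  expR (c - b * u) / b ^+ 5 * ((b * u) ^+ 4 + 4 * (b * u) ^+ 3
    + 12 * (b * u) ^+ 2 + 24 * (b * u) + 24).
Proof.
move=> b0 u0; have bn0 : b != 0 by rewrite gt_eqF.
rewrite (@moment_poly_expR (b^-1 *: 'X^4 + (4 / b^+2) *: 'X^3
  + (12 / b^+3) *: 'X^2 + (24 / b^+4) *: 'X + (24 / b ^+ 5)%:P))//.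
  by rewrite !(hornerD, hornerZ, hornerXn, hornerX, hornerC); field.
move=> x; rewrite !(derivD, derivZ, derivXn, derivX, derivC).
by rewrite !(hornerD, hornerZ, hornerMn, hornerXn, hornerX, hornerC)/=; field.
Qed.

Lemma moment_ratio_expR_lt c b u t : 0 < b -> 0 <= u -> u < t ->
  let E := fun v => moment `[v, +oo[ (fun x => expR (c - b * x)) in
  E t 4%N * E t 0%N * E u 2%N ^+ 2 < E u 4%N * E u 0%N * E t 2%N ^+ 2.
Proof.
move=> b0 u0 ut /=; have t0 := le_trans u0 (ltW ut).
rewrite !moment0_expR// !moment2_expR// !moment4_expR//.
have yz : b * u < b * t by rewrite ltr_pM2l.
(* Each side is the common factor [K] below times a polynomial expression in [b u] and [b t]
   alone. *)
have := expR_ratio_poly_lt (mulr_ge0 (ltW b0) u0) yz.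
set y := b * u; set z := b * t.
set Eu := expR _; set Et := expR _.
pose K := (Eu * Et) ^+ 2 / b ^+ 12.
have K0 : 0 < K.
  by rewrite divr_gt0 ?exprn_gt0// mulr_gt0 ?expR_gt0.
rewrite -(ltr_pM2l K0); congr (_ < _); rewrite /K; field; exact: lt0r_neq0.
Qed.

End expR_moments.

(** * The exponential with matching moments, and its crossings with [q] *)

Section exponential_comparison.
Context (R : realType).
Implicit Types (s t b c x y : R).

(** The cut is an infimum. Nothing is said at [a] itself; in the applications the test polynomial
    vanishes there. *)
Lemma up_closed_cut (P : R -> Prop) t y0 : t <= y0 -> P y0 ->
  (forall x y, t <= x -> x <= y -> P x -> P y) ->
  exists2 a, t <= a & forall x, t <= x -> (x < a -> ~ P x) /\ (a < x -> P x).
Proof.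
move=> ty0 Py0 Pup; pose S := [set x | t <= x /\ P x].
have S0 : S !=set0 by exists y0.
have lbS : lbound S t by move=> x [].
exists (inf S); first exact: lb_le_inf.
move=> x tx; split=> [xS Px|Sx].
  suff : inf S <= x by rewrite leNgt xS.
  by apply: ge_inf; [exists t|split].
have [y [ty Py] yx] := inf_lt S0 Sx.
exact: Pup (ltW yx) Py.
Qed.

Lemma expR_matching_moments t (m0 m2 : R) : 0 <= t -> 0 < m0 ->
  t ^+ 2 * m0 < m2 ->
  exists c b, [/\ 0 < b,
    moment `[t, +oo[ (fun x => expR (c - b * x)) 0 = m0 &
    moment `[t, +oo[ (fun x => expR (c - b * x)) 2 = m2].
Proof.
move=> t0 m00 tm.
have hr : t ^+ 2 < m2 / m0 by rewrite ltr_pdivlMr.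
(* The tail of rate [b] has [m2 / m0 = t^2 + 2 t / b + 2 / b^2]; with [r = t + 2 / b] this reads
   [r^2 + t^2 = 2 m2 / m0]. The constant [c] then fixes the value at [t] as [m0 b]. *)
pose r := Num.sqrt (2 * (m2 / m0) - t ^+ 2).
have r2 : r ^+ 2 = 2 * (m2 / m0) - t ^+ 2 by rewrite sqr_sqrtr//; nra.
have r0 : 0 <= r := sqrtr_ge0 _.
have tr : t < r by nra.
pose b := 2 / (r - t).
have b0 : 0 < b by rewrite divr_gt0// subr_gt0.
exists (ln (m0 * b) + b * t), b.
have E0 : expR (ln (m0 * b) + b * t - b * t) = m0 * b.
  by rewrite addrK lnK// posrE mulr_gt0.
split=> //; rewrite ?moment0_expR ?moment2_expR// E0.
  by rewrite mulfK// gt_eqF.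
have m2E : m2 = m0 * ((r ^+ 2 + t ^+ 2) / 2).
  by rewrite r2; field; rewrite gt_eqF.
rewrite m2E /b; field.
by rewrite subr_eq0 gt_eqF.
Qed.

Variable q : R -> R.
Hypothesis q_logconcave : logconcave q.

Section crossing.
Variables (t b c : R).
Hypothesis t0 : 0 <= t.
Hypothesis b0 : 0 < b.
Let e x := expR (c - b * x).
Hypothesis q_moments : has_moments `[t, +oo[ q.
Hypothesis eq_moment0 : moment `[t, +oo[ e 0 = moment `[t, +oo[ q 0.
Hypothesis eq_moment2 : moment `[t, +oo[ e 2 = moment `[t, +oo[ q 2.

Let e_moments : has_moments `[t, +oo[ e.
Proof. exact: has_moments_expR. Qed.

Let sqr_lt x y : 0 <= x -> x < y -> x ^+ 2 < y ^+ 2.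
Proof. by nra. Qed.

Let sqr_le x y : 0 <= x -> x <= y -> x ^+ 2 <= y ^+ 2.
Proof. by nra. Qed.

(** Otherwise [q < e] on the whole ray, against equality of the moments of order 0. *)
Lemma crossing_ge_expR : exists2 z, t <= z & e z <= q z.
Proof.
apply: contrapT => noz.
have qe x : t <= x -> q x < e x.
  by move=> tx; rewrite ltNge; apply/negP => ex; apply: noz; exists x.
have := @ltr_moments _ t t q e 0 0 1 0 0 1 q_moments e_moments.
rewrite !mul0r !add0r !mul1r eq_moment0 ltxx => absurd; suff : false by [];
  apply: absurd => x tx.
  by rewrite !mul0r !add0r !mul1r ltW// qe.
by rewrite !mul0r !add0r !mul1r qe.
Qed.

(* A single sign change of [q - e] at [a] is incompatible with equal moments of
   orders 0 and 2: test against [x ^+ 2 - a ^+ 2]. *)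
Let no_single_crossing (f g : R -> R) a :
  has_moments `[t, +oo[ f -> has_moments `[t, +oo[ g ->
  moment `[t, +oo[ f 0 = moment `[t, +oo[ g 0 ->
  moment `[t, +oo[ f 2 = moment `[t, +oo[ g 2 ->
  t <= a -> (forall x, t <= x -> x < a -> g x <= f x) ->
  (forall x, a < x -> f x < g x) -> False.
Proof.
move=> mf mg fg0 fg2 ta gf fg; have a0 := le_trans t0 ta.
have := @ltr_moments _ t a f g 0 1 (- a^+2) 0 1 (- a^+2) mf mg.
rewrite !mul0r fg0 fg2 ltxx => absurd; suff : false by [];
  apply: absurd => x tx.
  have x0 := le_trans t0 tx.
  rewrite !mul0r !add0r !mul1r; have [xa|ax|->] := ltgtP x a.
  - by have := sqr_le x0 (ltW xa); have := gf _ tx xa; nra.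
  - by have := sqr_lt a0 ax; have := fg _ ax; nra.
  - by rewrite subrr !mul0r.
move=> ax; rewrite !mul0r !add0r !mul1r.
by have := sqr_lt a0 ax; have := fg _ ax; nra.
Qed.

(** Suppose [q > e] at some [x < t]. As [q >= e] holds on an interval, [q - e] either turns negative
    exactly once on the ray or never does; equal moments exclude both. *)
Lemma crossing_le_expR x : x < t -> q x <= e x.
Proof.
move=> xt; rewrite leNgt; apply/negP => ex.
have [[y [ty qey]]|noy] := pselect (exists y, t <= y /\ q y < e y).
  have [|a ta aP] := @up_closed_cut (fun y => q y < e y) t y ty qey.
    move=> y1 y2 ty1 y12; rewrite !ltNge; apply: contraNN => ey2.
    apply: (@logconcave_ge_expR _ _ q_logconcave c b x y1 y2) => //.
      by rewrite y12 (le_trans (ltW xt)).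
    exact: ltW.
  apply: (@no_single_crossing q e a) => // [z tz za|z az].
    by rewrite leNgt; apply/negP; have [+ _] := aP _ tz; apply.
  by have [_] := aP _ (le_trans ta (ltW az)); apply.
have qe y : t <= y -> e y <= q y.
  by move=> ty; rewrite leNgt; apply/negP => qey; apply: noy; exists y.
(* Strictness at [x] carries over to [y], since [q >= e] at [y + 1]. *)
have {}qe y : t <= y -> e y < q y.
  move=> ty; apply: (@logconcave_gt_expR _ _ q_logconcave c b x y (y + 1)) =>
    //.
    by rewrite (le_trans (ltW xt))//= ltrDl.
  by apply: qe; rewrite (le_trans ty)// lerDl.
apply: (@no_single_crossing e q t) => // [z tz zt|z tz].
  by have := le_lt_trans tz zt; rewrite ltxx.
by apply: qe; exact: ltW.
Qed.

(** The set [J] where [q > e] on the ray is an interval with endpoints [a] and [d], so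
    [(x^2 - a^2) (x^2 - d^2) (q - e) <= 0]. On integrating, the terms of orders 0 and 2 cancel. *)
Lemma crossing_moment4 : moment `[t, +oo[ q 4 <= moment `[t, +oo[ e 4.
Proof.
pose J x := t <= x /\ e x < q x.
have Jconvex x y z : x <= y <= z -> J x -> J z -> J y.
  move=> /andP[xy]; rewrite le_eqVlt => /predU1P[->//|yz] [tx ex] [tz ez].
  split; first exact: le_trans xy.
  apply: (@logconcave_gt_expR _ _ q_logconcave c b x y z) => //.
    by rewrite xy.
  exact: ltW.
have nJ x : t <= x -> ~ J x -> q x <= e x.
  by move=> tx Jx; rewrite leNgt; apply/negP => ex; apply: Jx.
have mD : measurable (`[t, +oo[%classic : set (measurableTypeR R)) by [].
have [[x1 Jx1]|J0] := pselect (exists x, J x); last first.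
  have := @ler_moments _ `[t, +oo[%classic q e 1 0 0 1 0 0 mD q_moments
    e_moments.
  rewrite !mul1r !mul0r !addr0; apply => x /=; rewrite in_itv/= andbT => tx.
  rewrite !mul0r !addr0 !mul1r; have qe : q x <= e x.
    by apply: nJ => // Jx; apply: J0; exists x.
  have : 0 <= x ^+ 4 by rewrite exprn_ge0// (le_trans t0).
  by move=> x40; exact: ler_wpM2l.
have tx1 : t <= x1 by case: Jx1.
have Px1 : exists2 y, y <= x1 & J y by exists x1.
have [|a ta aP] :=
  @up_closed_cut (fun x => exists2 y, y <= x & J y) t x1 tx1 Px1.
  by move=> x y tx xy [z zx Jz]; exists z => //; exact: le_trans xy.
(* An unbounded [J] leaves a single sign change of [q - e], at [a], which equal moments forbid. *)
have [[x2 [tx2 x2J]]|Junbounded] :=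
    pselect (exists x, t <= x /\ forall y, x <= y -> ~ J y); last first.
  exfalso; apply: (@no_single_crossing e q a) => // [x tx xa|x ax].
    by apply: nJ => // Jx; have [+ _] := aP _ tx; apply => //; exists x.
  have tx := le_trans ta (ltW ax).
  have [_ /(_ ax)[y yx Jy]] := aP _ tx.
  have [z xz Jz] : exists2 z, x <= z & J z.
    apply: contrapT => noz; apply: Junbounded; exists x; split => // z xz Jz.
    by apply: noz; exists z.
  by have [] := Jconvex y x z _ Jy Jz; rewrite ?yx.
(* The right end of [J], as the cut of the points with no element of [J] from there on. *)
have [|d td dP] :=
  @up_closed_cut (fun x => forall y, x <= y -> ~ J y) t x2 tx2 x2J.
  by move=> x y tx xy xJ z yz; apply: xJ; exact: le_trans yz.
have ax1 : a <= x1.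
  by rewrite leNgt; apply/negP => x1a; have [+ _] := aP _ tx1; apply => //;
    exists x1.
have x1d : x1 <= d.
  by rewrite leNgt; apply/negP => dx1; have [_ /(_ dx1 _ (lexx _))] := dP _ tx1.
have a0 := le_trans t0 ta; have d0 := le_trans t0 td.
have := @ler_moments _ `[t, +oo[%classic q e 1 (- (a^+2 + d^+2)) (a^+2 * d^+2)
   1 (- (a^+2 + d^+2)) (a^+2 * d^+2) mD q_moments e_moments.
rewrite eq_moment0 eq_moment2 !mul1r !lerD2r; apply => x /=.
rewrite in_itv/= andbT => tx; have x0 := le_trans t0 tx.
rewrite (_ : 1 * x ^+ 4 + _ + _ = (x^+2 - a^+2) * (x^+2 - d^+2)); last by ring.
have [xa|ax|->] := ltgtP x a; last by rewrite subrr !mul0r.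
  have qe : q x <= e x.
    by apply: nJ => // Jx; have [+ _] := aP _ tx; apply => //; exists x.
  apply: ler_wpM2l => //; rewrite -mulrNN mulr_ge0// oppr_ge0 subr_le0 sqr_le//.
    exact: ltW.
  by rewrite (le_trans (ltW xa))// (le_trans ax1).
have [xd|dx|->] := ltgtP x d; last by rewrite subrr mulr0 !mul0r.
  have [_ /(_ ax)[y yx Jy]] := aP _ tx.
  have [z xz Jz] : exists2 z, x <= z & J z.
    apply: contrapT => noz; have [/(_ xd) + _] := dP _ tx; apply => z xz Jz.
    by apply: noz; exists z.
  have [_ /ltW ex] : J x by apply: (Jconvex y x z) => //; rewrite yx.
  apply: ler_wnM2l => //; rewrite mulr_ge0_le0// ?subr_ge0 ?subr_le0 sqr_le//;
    exact: ltW.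
have qe : q x <= e x.
  by apply: nJ => // Jx; have [_ /(_ dx x (lexx _))] := dP _ tx.
by apply: ler_wpM2l => //; rewrite mulr_ge0// subr_ge0 sqr_le// ltW.
Qed.

End crossing.
End exponential_comparison.

(** * The moment inequality for a logconcave function *)

Section ratio_monotone.
Context (R : realType).
Implicit Types (s t x : R).

(** The bound [4 (a x) (b y) <= (a x + b y)^2], arranged to avoid square roots. *)
Lemma amgm_le (a b m x y z : R) : 0 <= a * x -> 0 <= b * y ->
  m ^+ 2 * z ^+ 2 <= (a * b) * (x * y) -> 2 * m * z <= a * x + b * y.
Proof.
move=> ax0 by0 h; rewrite leNgt; apply/negP => lt.
have : (a * x + b * y) ^+ 2 < (2 * m * z) ^+ 2 by nra.
by have := sqr_ge0 (a * x - b * y); nra.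
Qed.

Lemma amgm_lt (a b m x y z : R) : 0 <= a * x -> 0 <= b * y ->
  m ^+ 2 * z ^+ 2 < (a * b) * (x * y) -> 2 * m * z < a * x + b * y.
Proof.
move=> ax0 by0 h; rewrite ltNge; apply/negP => le.
have : (a * x + b * y) ^+ 2 <= (2 * m * z) ^+ 2 by nra.
by have := sqr_ge0 (a * x - b * y); nra.
Qed.

(* [N_k] and [H_k] stand for the moments, over the rays from [s] and from [t],
   of the function equal to [q] on the left of [t] and to the matching
   exponential [e] on its right; [E_k] are the moments of [e] over the ray from
   [u], and
   [m = N0 * N4 / N2] makes the test polynomial [N0 x^4 - 2 m x^2 + N4] have
   integral zero. *)
Lemma ratio_algebra (N0 N2 N4 H0 H2 H4 E0 E2 E4 om : R) :
  0 < N0 -> 0 < N2 -> 0 < N4 -> 0 < H0 -> 0 < H2 -> 0 < H4 ->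
  0 < E0 -> 0 < E4 -> 0 <= om <= 1 ->
  let m := N0 * N4 / N2 in
  om * (N0 * (E4 - H4) - 2 * m * (E2 - H2) + N4 * (E0 - H0)) <=
    N0 * (N4 - H4) - 2 * m * (N2 - H2) + N4 * (N0 - H0) ->
  H4 * H0 * E2 ^+ 2 < E4 * E0 * H2 ^+ 2 ->
  H4 * H0 * N2 ^+ 2 <= N4 * N0 * H2 ^+ 2 /\
  (0 < om -> H4 * H0 * N2 ^+ 2 < N4 * N0 * H2 ^+ 2).
Proof.
move=> N00 N20 N40 H00 H20 H40 E00 E40 /andP[om0 om1] m.
have mN2 : m * N2 = N0 * N4 by rewrite /m mulfVK// gt_eqF.
have N22 : 0 < N2 ^+ 2 by rewrite exprn_gt0.
have H22 : 0 < H2 ^+ 2 by rewrite exprn_gt0.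
have N04 : 0 < N0 * N4 by rewrite mulr_gt0.
pose I x4 x2 x0 := N0 * x4 + N4 * x0 - 2 * m * x2.
move=> hom EH.
(* [I] integrates the test polynomial and vanishes on the [N] moments, so the hypothesis says that a
   convex combination of its values on [E] and [H] is at most 0. *)
have {}hom : om * I E4 E2 E0 + (1 - om) * I H4 H2 H0 <= 0.
  by move: hom; rewrite /I; nra.
have mE x4 x2 x0 : (m ^+ 2 * x2 ^+ 2 <= N0 * N4 * (x4 * x0)) =
    (N0 * N4 * x2 ^+ 2 * H2 ^+ 2 <= x4 * x0 * H2 ^+ 2 * N2 ^+ 2).
  rewrite -(ler_pM2r N22) (_ : m^+2 * x2^+2 * N2^+2 = (m * N2)^+2 * x2^+2);
    last by ring.
  rewrite mN2 (_ : _ * x2^+2 = (N0 * N4) * (N0 * N4 * x2^+2)); last by ring.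
  by rewrite -!mulrA !(ler_pM2l N00) !(ler_pM2l N40) -(ler_pM2r H22);
    congr (_ <= _); ring.
have mE' x4 x2 x0 : (m ^+ 2 * x2 ^+ 2 < N0 * N4 * (x4 * x0)) =
    (N0 * N4 * x2 ^+ 2 * H2 ^+ 2 < x4 * x0 * H2 ^+ 2 * N2 ^+ 2).
  rewrite -(ltr_pM2r N22) (_ : m^+2 * x2^+2 * N2^+2 = (m * N2)^+2 * x2^+2);
    last by ring.
  rewrite mN2 (_ : _ * x2^+2 = (N0 * N4) * (N0 * N4 * x2^+2)); last by ring.
  by rewrite -!mulrA !(ltr_pM2l N00) !(ltr_pM2l N40) -(ltr_pM2r H22);
    congr (_ < _); ring.
have NH x2 : N4 * N0 * H2^+2 <= H4 * H0 * N2^+2 ->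
    N0 * N4 * x2 ^+ 2 * H2 ^+ 2 <= H4 * H0 * x2^+2 * N2^+2.
  move=> h; have := ler_wpM2r (sqr_ge0 x2) h.
  by congr (_ <= _); ring.
(* If the conclusion fails, the arithmetic-geometric mean inequality makes [I] positive on [E] and
   nonnegative on [H], or positive on [H] under strict failure, contradicting [hom]. *)
have IE : N4 * N0 * H2^+2 <= H4 * H0 * N2^+2 -> 0 < I E4 E2 E0.
  move=> h; rewrite /I subr_gt0; apply: amgm_lt;
    [by rewrite mulr_ge0 ?ltW|by rewrite mulr_ge0 ?ltW|].
  rewrite mE'; apply: le_lt_trans (NH E2 h) _.
  by rewrite ltr_pM2r.
have IH : N4 * N0 * H2^+2 <= H4 * H0 * N2^+2 -> 0 <= I H4 H2 H0.
  move=> h; rewrite /I subr_ge0; apply: amgm_le;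
    [by rewrite mulr_ge0 ?ltW|by rewrite mulr_ge0 ?ltW|].
  by rewrite mE; exact: NH.
have IH' : N4 * N0 * H2^+2 < H4 * H0 * N2^+2 -> 0 < I H4 H2 H0.
  move=> h; rewrite /I subr_gt0; apply: amgm_lt;
    [by rewrite mulr_ge0 ?ltW|by rewrite mulr_ge0 ?ltW|].
  rewrite mE'; have := ltr_pM2r H22 (N4 * N0 * H2^+2) (H4 * H0 * N2^+2).
  by rewrite h; congr (_ < _ = _); ring.
clearbody I; clear mE mE' NH.
split=> [|om_gt0].
  rewrite leNgt; apply/negP => h.
  by have := IE (ltW h); have := IH' h; nra.
rewrite ltNge; apply/negP => h.
by have := IE h; have := IH h; nra.
Qed.

Variable q : R -> R.
Hypothesis q_logconcave : logconcave q.
Hypothesis q_ge0 : forall x, 0 <= q x.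
Hypothesis q_measurable : measurable_fun setT q.

(** The comparison of moment ratios with denominators cleared. Strictness comes from [om > 0], which
    holds as soon as [q s > 0]. *)
Lemma moment_ratio_le s t : 0 <= s -> s < t ->
  has_moments `[s, +oo[ q -> 0 < moment `[t, +oo[ q 0 ->
  let M u k := moment `[u, +oo[ q k in
  M t 4%N * M t 0%N * M s 2%N ^+ 2 <= M s 4%N * M s 0%N * M t 2%N ^+ 2 /\
  (0 < q s ->
  M t 4%N * M t 0%N * M s 2%N ^+ 2 < M s 4%N * M s 0%N * M t 2%N ^+ 2).
Proof.
move=> s0 st ms At0 /=; have t0 : 0 <= t := le_trans s0 (ltW st).
have mray (v : R) :
  measurable (`[v, +oo[%classic : set (measurableTypeR R)) by [].
have mt : has_moments `[t, +oo[ q.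
  apply: has_momentsS ms => // x /=; rewrite !in_itv/= !andbT;
    exact/le_trans/ltW.
have At2 := moment2_gt t0 q_ge0 q_measurable mt At0.
have [c [b [b0 eq0 eq2]]] := expR_matching_moments t0 At0 At2.
pose e x := expR (c - b * x).
have [z0 tz0 ez0] := crossing_ge_expR t0 b0 mt eq0.
have qe x : x < t -> q x <= e x :=
  @crossing_le_expR _ _ q_logconcave _ _ _ t0 b0 mt eq0 eq2 x.
have le4 := crossing_moment4 q_logconcave t0 b0 mt eq0 eq2.
have e0 x : 0 < e x := expR_gt0 _.
have me (v : R) : 0 <= v -> has_moments `[v, +oo[ e by exact: has_moments_expR.
pose D k := moment `[s, t[ q k.
have ND k : moment `[s, +oo[ q k = D k + moment `[t, +oo[ q k.
  by apply: moment_itv_split => //; exact: ltW.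
have D0 k : 0 <= D k.
  by apply: moment_ge0 => // x /=; rewrite in_itv/= => /andP[/(le_trans s0)].
have t2A0 : 0 <= t ^+ 2 * moment `[t, +oo[ q 0.
  by rewrite mulr_ge0 ?sqr_ge0 ?ltW.
have {}At2 : 0 < moment `[t, +oo[ q 2 by exact: le_lt_trans At2.
(* Cauchy-Schwarz, from integrating [(x^2 - k)^2 q] with [k] the mean of [x^2]; it yields positivity
   of the fourth moment. *)
have CS : moment `[t, +oo[ q 2 ^+ 2 <=
    moment `[t, +oo[ q 4 * moment `[t, +oo[ q 0.
  pose k := moment `[t, +oo[ q 2 / moment `[t, +oo[ q 0.
  have := @ler_moments _ `[t, +oo[%classic q q 0 0 0 1 (- 2 * k) (k ^+ 2)
    (mray _) mt mt.
  rewrite !mul0r !addr0 !mul1r => h.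
  have {}h : 0 <= moment `[t, +oo[ q 4 -
      2 * k * moment `[t, +oo[ q 2 + k ^+ 2 * moment `[t, +oo[ q 0.
    rewrite -mulNr -mulNr; apply: h => x _; rewrite !mul0r !addr0 mul0r.
    rewrite (_ : 1 * _ + _ + _ = (x^+2 - k)^+2); last by ring.
    by rewrite mulr_ge0// sqr_ge0.
  have kA : k * moment `[t, +oo[ q 0 = moment `[t, +oo[ q 2.
    by rewrite /k mulfVK// gt_eqF.
  rewrite -subr_ge0 -kA.
  have := mulr_ge0 h (ltW At0); congr (0 <= _).
  by rewrite -kA; ring.
have At4 : 0 < moment `[t, +oo[ q 4.
  by rewrite -(pmulr_lgt0 _ At0); apply: lt_le_trans CS; rewrite exprn_gt0.
have Ht4 : 0 < moment `[t, +oo[ e 4 := lt_le_trans At4 le4.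
have eposU (v : R) : 0 <= v ->
    0 < moment `[v, +oo[ e 0 /\ 0 < moment `[v, +oo[ e 4.
  move=> v0; have bv : 0 <= b * v by rewrite mulr_ge0// ltW.
  rewrite moment0_expR// moment4_expR//; split.
    by rewrite divr_gt0// expR_gt0.
  apply: mulr_gt0; first by rewrite divr_gt0 ?expR_gt0 ?exprn_gt0.
  by rewrite ltr_wpDl ?ltr0n// !addr_ge0 ?mulr_ge0 ?exprn_ge0// ltW.
pose N0 := moment `[s, +oo[ q 0; pose N2 := moment `[s, +oo[ q 2.
(* Only the fourth moment changes when [q] is replaced by [e] beyond [t]: those of orders 0 and 2
   match. *)
pose N4 := D 4%N + moment `[t, +oo[ e 4.
have N00 : 0 < N0 by rewrite /N0 ND ltr_wpDl.
have N20 : 0 < N2 by rewrite /N2 ND ltr_wpDl.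
have N40 : 0 < N4 by rewrite /N4 ltr_wpDl.
pose m := N0 * N4 / N2.
pose w x := q x / e x.
have [||om [u [/andP[su ut] om01 wom pq pwe]]] :=
  @sign_change_weight _ N0 m N4 s t w N00 s0 st.
- move=> x /andP[sx xt]; rewrite divr_ge0 ?(ltW (e0 _))//=.
  by rewrite ler_pdivrMr// mul1r qe.
- move=> x y sx xy yt; rewrite ler_pdivrMr// mulrAC ler_pdivlMr//.
  apply: (@logconcave_ratio_homo _ _ q_logconcave c b x y z0) => //.
    by rewrite xy (le_trans (ltW yt)).
  by apply: qe; exact: le_lt_trans yt.
have u0 := le_trans s0 su.
have msu : has_moments `[s, u[ q.
  by apply: has_momentsS ms => // x /=; rewrite !in_itv/= andbT => /andP[].
have mut : has_moments `[u, t[ q.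
  apply: has_momentsS ms => // x /=; rewrite !in_itv/= andbT => /andP[ux _].
  exact: le_trans ux.
have meut : has_moments `[u, t[ e.
  by apply: has_momentsS (me u u0) => // x /=;
    rewrite !in_itv/= andbT => /andP[].
have Dsplit k : D k = moment `[s, u[ q k + moment `[u, t[ q k.
  apply: moment_itv_split => //; first by rewrite bnd_simp; exact: ltW.
  apply: has_momentsS ms => // x /=; rewrite !in_itv/= andbT => /andP[] //.
have Esplit k : moment `[u, +oo[ e k - moment `[t, +oo[ e k =
    moment `[u, t[ e k.
  rewrite (@moment_itv_split _ u t) ?addrK//; first exact: ltW.
  exact: me.
(* On [[s, u[] the test polynomial is nonnegative; on [[u, t[] the weight [w] is traded for the
   constant [om]. The sum of [h1] and [h2] is the hypothesis of [ratio_algebra]. *)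
have h1 : 0 <= N0 * moment `[s, u[ q 4 -
    2 * m * moment `[s, u[ q 2 + N4 * moment `[s, u[ q 0.
  have := @ler_moments _ `[s, u[%classic q q 0 0 0 N0 (- (2 * m)) N4
    (measurable_itv _) msu msu.
  rewrite !mul0r !addr0 mulNr; apply => x /=; rewrite in_itv/= => sxu.
  by rewrite !mul0r !addr0 mul0r mulr_ge0// mulNr pq.
have h2 : om * (N0 * moment `[u, t[ e 4 - 2 * m * moment `[u, t[ e 2 +
      N4 * moment `[u, t[ e 0) <=
    N0 * moment `[u, t[ q 4 - 2 * m * moment `[u, t[ q 2 +
      N4 * moment `[u, t[ q 0.
  have := @ler_moments _ `[u, t[%classic e q (om * N0) (om * - (2 * m))
    (om * N4) N0 (- (2 * m)) N4 (measurable_itv _) meut mut => h.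
  suff : om * N0 * moment `[u, t[ e 4 + om * - (2 * m) * moment `[u, t[ e 2 +
      om * N4 * moment `[u, t[ e 0 <= N0 * moment `[u, t[ q 4 +
      - (2 * m) * moment `[u, t[ q 2 + N4 * moment `[u, t[ q 0.
    by congr (_ <= _); ring.
  apply: h => x /=; rewrite in_itv/= => uxt.
  have := ler_wpM2r (ltW (e0 x)) (pwe x uxt).
  rewrite (_ : w x * _ * e x = (N0 * x^+4 - 2 * m * x^+2 + N4) * (w x * e x));
    last by ring.
  rewrite /w mulfVK ?gt_eqF// mulNr; congr (_ <= _).
  by ring.
have [E00 E40] := eposU u u0.
have := @ratio_algebra N0 N2 N4
  (moment `[t, +oo[ q 0) (moment `[t, +oo[ q 2) (moment `[t, +oo[ e 4)
  (moment `[u, +oo[ e 0) (moment `[u, +oo[ e 2) (moment `[u, +oo[ e 4) om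
  N00 N20 N40 At0 At2 Ht4 E00 E40 om01.
rewrite -/m /= -eq0 -eq2 !Esplit.
have -> : N4 - moment `[t, +oo[ e 4 = D 4%N by rewrite /N4 addrK.
have -> : N2 - moment `[t, +oo[ e 2 = D 2%N by rewrite eq2 /N2 ND addrK.
have -> : N0 - moment `[t, +oo[ e 0 = D 0%N by rewrite eq0 /N0 ND addrK.
case.
- by have := lerD h1 h2; rewrite add0r !Dsplit; congr (_ <= _); ring.
- exact: moment_ratio_expR_lt.
rewrite eq0 eq2 => le lt.
(* Undoing the replacement: after cancellation this is [crossing_moment4] multiplied by [D 4]. *)
have N44 : moment `[t, +oo[ q 4 * N4 <=
    moment `[s, +oo[ q 4 * moment `[t, +oo[ e 4.
  rewrite /N4 ND mulrDr mulrDl lerD2r mulrC.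
  by apply: ler_wpM2l.
have bound : moment `[t, +oo[ q 4 * (N4 * N0 * moment `[t, +oo[ q 2 ^+ 2) <=
    moment `[t, +oo[ e 4 *
      (moment `[s, +oo[ q 4 * N0 * moment `[t, +oo[ q 2 ^+ 2).
  have NA0 : 0 <= N0 * moment `[t, +oo[ q 2 ^+ 2.
    by rewrite mulr_ge0 ?sqr_ge0 ?ltW.
  by have := ler_wpM2r NA0 N44; congr (_ <= _); ring.
rewrite -/N0 -/N2; split=> [|qs].
  rewrite -(ler_pM2l Ht4); apply: le_trans bound.
  by have := ler_wpM2l (ltW At4) le; congr (_ <= _); ring.
have {}lt : moment `[t, +oo[ e 4 * moment `[t, +oo[ q 0 * N2 ^+ 2 <
    N4 * N0 * moment `[t, +oo[ q 2 ^+ 2.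
  by apply: lt; apply: wom; rewrite divr_gt0.
rewrite -(ltr_pM2l Ht4); apply: lt_le_trans bound.
by move: lt; rewrite -(ltr_pM2l At4); congr (_ < _); ring.
Qed.

End ratio_monotone.

(** * Finite moments and integration against a density *)

Section density.
Context (R : realType).
Notation mu := (@lebesgue_measure R).
Implicit Types (s t b c x y : R).

(** Integrability forces [q] to drop below some earlier positive value; from there on logconcavity
    imposes exponential decay. *)
Lemma logconcave_has_moments (q : R -> R) s : logconcave q ->
  (forall x, 0 <= q x) -> mu.-integrable setT (EFin \o q) -> 0 <= s ->
  has_moments `[s, +oo[ q.
Proof.
move=> qlc q0 iq s0.
have mq : measurable_fun setT q by apply/measurable_EFinP;
  exact: (measurable_int mu).
have mray (v : R) :
  measurable (`[v, +oo[%classic : set (measurableTypeR R)) by [].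
have [c [b [x1 [b0 qe]]]] : exists c b x1, 0 < b /\
    forall x, x1 <= x -> q x <= expR (c - b * x).
  have [[a qa]|noa] := pselect (exists a, 0 < q a); last first.
    exists 0, 1, 0; split => // x _; rewrite (le_trans _ (expR_ge0 _))//.
    by rewrite leNgt; apply/negP => qx; apply: noa; exists x.
  have [[d [ad qda]]|nod] := pselect (exists d, a < d /\ q d < q a); last first.
    have qge x : a <= x -> q a <= q x.
      rewrite le_eqVlt => /predU1P[->//|ax]; rewrite leNgt; apply/negP => qx.
      by apply: nod; exists x.
    have iqa := integrableS measurableT (mray a) (@subsetT _ _) iq.
    have : (\int[mu]_(x in `[a, +oo[) (q a)%:E < +oo)%E.
      apply: le_lt_trans (integrable_lty (mray a) iqa).
      apply: ge0_le_integral => //=.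
      - by move=> x _; rewrite lee_fin.
      - by have /integrableP[] := iqa.
      - by move=> x; rewrite in_itv/= andbT lee_fin; exact: qge.
    rewrite integral_cst//= lebesgue_measure_itv/= ltry.
    by rewrite addye// gt0_muley ?lte_fin// ltxx.
  (* The midpoint is positive even if [q d = 0]. The exponential through [(a, q a)] and [(d, y)]
     dominates [q] beyond [d], since exceeding it there would force [y <= q d]. *)
  pose y := (q a + q d) / 2.
  have qd0 := q0 d.
  have ya : y < q a by rewrite /y; lra.
  have dy : q d < y by rewrite /y; lra.
  have y0 : 0 < y by exact: le_lt_trans dy.
  pose b := (ln (q a) - ln y) / (d - a).
  have b0 : 0 < b by rewrite divr_gt0 ?subr_gt0// ltr_ln.
  exists (ln (q a) + b * a), b, d; split => // x dx; rewrite leNgt;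
    apply/negP => ex.
  have := @logconcave_ge_expR _ _ qlc (ln (q a) + b * a) b a d x.
  rewrite (ltW ad) dx addrK lnK// lexx => /(_ isT isT (ltW ex)).
  have -> : ln (q a) + b * a - b * d = ln y.
    by rewrite /b; field; rewrite subr_eq0 gt_eqF.
  by rewrite lnK// leNgt dy.
move=> k; have iqs := integrableS measurableT (mray s) (@subsetT _ _) iq.
pose K := `|x1| ^+ k; have K0 : 0 <= K by rewrite exprn_ge0.
have i1 := integrableZl (mray s) K iqs.
have := integrableD (mray s) i1 (has_moments_expR c b0 s0 k).
apply: le_integrable => //.
  apply/measurable_EFinP; apply: measurable_funM; last exact: measurable_funTS.
  exact: measurable_funX.
move=> x /=; rewrite in_itv/= andbT => sx; have x0 := le_trans s0 sx.
rewrite lee_fin !ger0_norm; last 2 first.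
  by rewrite addr_ge0// mulr_ge0// ?exprn_ge0 ?expR_ge0.
  by rewrite mulr_ge0 ?exprn_ge0.
have [x1x|xx1] := leP x1 x.
  by rewrite ler_wpDl ?mulr_ge0// ler_wpM2l ?exprn_ge0// qe.
rewrite ler_wpDr ?mulr_ge0 ?exprn_ge0 ?expR_ge0// ler_wpM2r//.
by rewrite lerXn2r ?nnegrE// (le_trans (ltW xx1))// ler_norm.
Qed.

(** Having the same integrals over measurable sets, [d] agrees almost everywhere with the
    Radon-Nikodym derivative of [P], for which the change of variables is known. *)
Lemma integral_has_density (P : probability (measurableTypeR R) R)
    (d f : R -> R) :
  has_density P d -> measurable_fun setT f -> (forall x, 0 <= f x) ->
  (\int[P]_x (f x)%:E = \int[mu]_x (f x * d x)%:E)%E.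
Proof.
move=> [md d0 Pd] mf f0.
have Pmu : P `<< mu.
  apply/null_content_dominatesP => A mA A0.
  rewrite Pd//; apply: null_set_integral => //.
  by apply/measurable_EFinP; exact: measurable_funTS.
rewrite -(Radon_Nikodym_SigmaFinite.change_of_variables Pmu)//=; last first.
  by apply/measurable_EFinP.
apply: ae_eq_integral => //.
- apply: emeasurable_funM; first exact/measurable_EFinP.
  by have /integrableP[] := Radon_Nikodym_SigmaFinite.f_integrable Pmu.
- by apply/measurable_EFinP; exact: measurable_funM.
have := @integral_ae_eq _ _ _ mu setT measurableT (EFin \o d) _
  (Radon_Nikodym_SigmaFinite.f_integrable Pmu).
move=> /(_ _ _)/=.
have : measurable_fun setT (EFin \o d) by exact/measurable_EFinP.
move=> md' /(_ md') h.
have {}h := h (fun E _ mE => etrans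
  (esym (Radon_Nikodym_SigmaFinite.f_integral Pmu mE)) (Pd E mE)).
by apply: filterS h => x /= h Tx; rewrite h// EFinM.
Qed.

End density.

(** * Moments of the restricted distribution *)

Section restrict_ray_moments.
Context (R : realType).
Notation mu := (@lebesgue_measure R).
Variables (q : R -> R) (Q : probability (measurableTypeR R) R) (t : R).
Hypothesis q_density : has_density Q q.
Hypothesis t_mass : (0 < Q `[t, +oo[%classic)%E.
Let ray : set (measurableTypeR R) := `[t, +oo[%classic.
Let mray : measurable ray := measurable_itv _.

Lemma fine_measure_ray : fine (Q ray) = moment ray q 0.
Proof.
have [_ _ Qd] := q_density; rewrite Qd// /moment /Rintegral.
by under [in RHS]eq_integral do rewrite expr0 mul1r.
Qed.

Lemma moment0_ray_gt0 : 0 < moment ray q 0.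
Proof.
rewrite -fine_measure_ray fine_gt0// t_mass.
by rewrite -ge0_fin_numE ?fin_num_measure.
Qed.

Lemma restrict_ray_has_density :
  has_density (restrict_ray Q t) (fun x => \1_ray x * (q x / moment ray q 0)).
Proof.
have [mq q0 Qd] := q_density; have M0 := moment0_ray_gt0.
split.
- apply: measurable_funM; first exact: measurable_indic.
  by apply: measurable_funM.
- by move=> x; rewrite mulr_ge0// divr_ge0// ltW.
move=> A mA.
have -> : restrict_ray Q t A = (Q (A `&` ray) * (fine (Q ray))^-1%:E)%E.
  have rayT : Q ray = Q ([set: measurableTypeR R] `&` ray) by rewrite setTI.
  rewrite rayT; set m := Q ([set: measurableTypeR R] `&` ray).
  have m_gt0 : (0 < m)%E by rewrite /m -rayT.
  have m_lty : (m < +oo)%E by rewrite /m -rayT -ge0_fin_numE ?fin_num_measure.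
  (* Exposes the case split of [mnormalize]; a positive finite mass rules out the default
     measure. *)
  rewrite -[LHS]/((if (m == 0)%E || (m == +oo)%E then fun U => Q U
                   else fun U => (Q (U `&` ray) * (fine m)^-1%:E)%E) A).
  by rewrite gt_eqF// lt_eqF.
rewrite fine_measure_ray Qd; last exact: measurableI.
rewrite integral_mkcondr muleC -ge0_integralZl_EFin//=.
- apply: eq_integral => x _; rewrite patchE indicE.
  by case: (x \in _); rewrite ?mule0 ?mul0r// mul1r -EFinM mulrC.
- by move=> x _; rewrite patchE; case: ifP => // _; rewrite lee_fin.
- apply/measurable_restrict => //; apply/measurable_EFinP.
  exact: measurable_funTS.
- by rewrite invr_ge0 ltW.
Qed.

Lemma expectation_restrict_ray (a b c : R) :
  has_moments ray q -> (forall x, 0 <= a * x ^+ 4 + b * x ^+ 2 + c) ->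
  fine 'E_(restrict_ray Q t)[fun x => a * x ^+ 4 + b * x ^+ 2 + c] =
  (a * moment ray q 4 + b * moment ray q 2 + c * moment ray q 0) /
    moment ray q 0.
Proof.
move=> qm p0; have M0 := moment0_ray_gt0.
have [iq <-] := integral_biquadratic a b c mray qm.
rewrite unlock (integral_has_density restrict_ray_has_density)//; last first.
  apply: measurable_funD => //; apply: measurable_funD;
    by apply: measurable_funM => //; exact: measurable_funX.
rewrite -RintegralZr// Rintegral_mkcond.
congr fine; apply: eq_integral => x _; rewrite patchE indicE.
by case: (x \in _); rewrite ?mul0r ?mulr0// mul1r mulrA.
Qed.

Lemma moment_ratio_restrict_ray : has_moments ray q ->
  0 < moment ray q 2 ->
  moment_ratio (restrict_ray Q t) =
  moment ray q 4 * moment ray q 0 / moment ray q 2 ^+ 2 - 1.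
Proof.
move=> qm M2; have M0 := moment0_ray_gt0.
have E2 : fine 'E_(restrict_ray Q t)[fun x => x ^+ 2] =
  moment ray q 2 / moment ray q 0.
  have -> : (fun x : R => x ^+ 2) = (fun x => 0 * x ^+ 4 + 1 * x ^+ 2 + 0).
    by apply/funext => x; ring.
  rewrite expectation_restrict_ray//; first by rewrite !mul0r mul1r addr0 add0r.
  by move=> x; rewrite mul0r add0r mul1r addr0 sqr_ge0.
set m := moment ray q 2 / moment ray q 0 in E2.
(* Expanding [(x^2 - m)^2], with [m] the mean of [x^2], gives a quartic of the required form,
   nonnegative as a square. *)
have VE : ('V_(restrict_ray Q t)[(fun x : R => x ^+ 2)%R] =
    'E_(restrict_ray Q t)[(fun x : R => 1 * x ^+ 4 + (- 2 * m) * x ^+ 2 +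
      m ^+ 2)%R])%E.
  rewrite /variance unlock E2; congr expectation; apply/funext => x.
  by rewrite !fctE /=; ring.
rewrite /moment_ratio E2 VE.
rewrite expectation_restrict_ray//.
  by rewrite /m; field; rewrite !gt_eqF.
by move=> x; rewrite (_ : _ + _ = (x ^+ 2 - m) ^+ 2) ?sqr_ge0//; ring.
Qed.

End restrict_ray_moments.

Unset Implicit Arguments.

(** If [[s, t[] has no mass, the two restrictions are the same measure; hence the mass condition for
    strictness. *)
Theorem lemma3 (R : realType) (q : R -> R)
    (Q : probability (measurableTypeR R) R)
    (q_density : has_density Q q)
    (q_logconcave : logconcave q)
    (q_support : [set x | q x != 0] `<=` `[0, +oo[)
    (s t : R) (s_ge0 : 0 <= s) (lt_st : s < t)
    (t_mass : (0 < Q `[t, +oo[%classic)%E) :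
  moment_ratio (restrict_ray Q t) <= moment_ratio (restrict_ray Q s) /\
  ((0 < Q `[s, t[%classic)%E ->
     moment_ratio (restrict_ray Q t) < moment_ratio (restrict_ray Q s)).
Proof.
have [mq q0 Qd] := q_density.
have iq : lebesgue_measure.-integrable setT (EFin \o q).
  apply/integrableP; split; first exact/measurable_EFinP.
  under eq_integral do rewrite /= ger0_norm//.
  by rewrite -Qd// probability_setT ltry.
have qm u : 0 <= u -> has_moments `[u, +oo[ q :=
  logconcave_has_moments q_logconcave q0 iq.
have mass u : u <= t -> (0 < Q `[u, +oo[%classic)%E.
  move=> ut; apply: lt_le_trans t_mass _; apply: le_measure; rewrite ?inE//=.
  by move=> x /=; rewrite !in_itv/= !andbT; exact: le_trans.
have M2 u : 0 <= u -> u <= t -> 0 < moment `[u, +oo[ q 2.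
  move=> u0 ut; have M0 := moment0_ray_gt0 q_density (mass u ut).
  apply: le_lt_trans (moment2_gt u0 q0 mq (qm u u0) M0).
  by rewrite mulr_ge0 ?sqr_ge0 ?ltW.
have ratioE u : 0 <= u -> u <= t -> moment_ratio (restrict_ray Q u) =
    moment `[u, +oo[ q 4 * moment `[u, +oo[ q 0 / moment `[u, +oo[ q 2 ^+ 2 - 1.
  move=> u0 ut; apply: moment_ratio_restrict_ray => //;
    [exact: mass|exact: qm|exact: M2].
have mono u v : 0 <= u -> u < v -> v <= t ->
    moment_ratio (restrict_ray Q v) <= moment_ratio (restrict_ray Q u) /\
    (0 < q u -> moment_ratio (restrict_ray Q v) <
      moment_ratio (restrict_ray Q u)).
  move=> u0 uv vt; have v0 := le_trans u0 (ltW uv);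
    have ut := le_trans (ltW uv) vt.
  have M0 := moment0_ray_gt0 q_density (mass v vt).
  have [le lt] := moment_ratio_le q_logconcave q0 mq u0 uv (qm u u0) M0.
  have Mu : 0 < moment `[u, +oo[ q 2 ^+ 2 by rewrite exprn_gt0 ?M2.
  have Mv : 0 < moment `[v, +oo[ q 2 ^+ 2 by rewrite exprn_gt0 ?M2.
  rewrite !ratioE// lerD2r ltrD2r; split=> [|qu].
    by rewrite ler_pdivrMr// mulrAC ler_pdivlMr.
  by rewrite ltr_pdivrMr// mulrAC ltr_pdivlMr// lt.
split; first by have [] := mono s t s_ge0 lt_st (lexx _).
move=> st_mass.
(* Possibly [q s = 0], so strictness is taken from a point [r] of [[s, t[] with [q r > 0], and the
   weak inequality covers [s] to [r]. *)
have [r [/andP[sr rt] qr]] : exists r, s <= r < t /\ 0 < q r.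
  apply: contrapT => nor; move: st_mass;
    rewrite Qd// integral0_eq ?ltxx// => x /=.
  rewrite in_itv/= => sxt; congr EFin; apply/eqP; rewrite eq_le q0 andbT leNgt.
  by apply/negP => qx; apply: nor; exists x.
have r0 := le_trans s_ge0 sr.
have [_ /(_ qr) lt] := mono r t r0 rt (lexx _).
apply: lt_le_trans lt _; move: sr; rewrite le_eqVlt => /predU1P[->//|sr].
by have [] := mono s r s_ge0 sr (ltW rt).
Qed.
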